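(* Let $k\ge 2$ be an integer, let $a$ be a nonnegative integer, and let $c>k$ be a real root of the polynomial $P(x) = x^{\underline{k}} - a!$. Then $$c \in \left[\sqrt[k]{a!} + \frac{k-1}{2},\ \sqrt[k]{a!} + \frac{k-1}{2} + \frac{k^2}{c-k}\right].$$
   Context: For real $x$ and integer $k\ge 1$, $x^{\underline{k}} := x(x-1)\cdots(x-k+1)$ denotes the $k$-th falling factorial. *)

(* Defs.v *)
From HB Require Import structures.
From mathcomp Require Import all_boot all_order all_algebra.
From mathcomp Require Import reals exp.

Set Implicit Arguments.
Unset Strict Implicit.
Unset Printing Implicit Defensive.

Import Order.TTheory GRing.Theory Num.Theory.

Local Open Scope ring_scope.

(* Stated in an arbitrary commutative ring so that it applies both to a real
   number x and to the indeterminate 'X; [horner_falling] relates the two. *)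
Definition falling (A : comNzRingType) (x : A) (k : nat) : A :=
  \prod_(i < k) (x - i%:R).

Lemma horner_falling (A : comNzRingType) (k : nat) (x : A) :
  (falling ('X : {poly A}) k).[x] = falling x k.
Proof.
rewrite /falling horner_prod; apply: eq_bigr => i _.
by rewrite !hornerE -polyC_natr hornerC.
Qed.

Definition fallingP (A : comNzRingType) (k a : nat) : {poly A} :=
  falling 'X k - (a`!%:R)%:P.

(* Main.v *)
Require Import Defs.
From HB Require Import structures.
From mathcomp Require Import all_boot all_order all_algebra.
From mathcomp Require Import reals exp.
From mathcomp Require Import ring lra.

Import Order.TTheory GRing.Theory Num.Theory.

Local Open Scope ring_scope.

(** Pair the factor [c - i] with its mirror image [c - (k - 1 - i)].  With
    [y = c - (k - 1) / 2] and [m = (k - 1) / 2] the product of a pair is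
    [y ^ 2 - (m - i) ^ 2], which lies between [y ^ 2 - m ^ 2] and [y ^ 2].
    Hence the [k]-th root [r] of the falling factorial satisfies
    [y ^ 2 - m ^ 2 <= r ^ 2 <= y ^ 2].  The right inequality is the lower bound
    on [c]; the left one gives [y - t <= r] for [t = k ^ 2 / (c - k)], since
    when [t <= y] one has [2 y t - t ^ 2 >= y t >= (c - k) t = k ^ 2 >= m ^ 2]. *)

(** Squaring lets every factor meet its mirror image, so the parity of [k] never matters. *)
Lemma falling_sqr (A : comNzRingType) (x : A) (k : nat) :
  falling x k ^+ 2 = \prod_(i < k) ((x - i%:R) * (x - k%:R + 1 + i%:R)).
Proof.
rewrite expr2 {2}/falling (reindex_inj rev_ord_inj) /falling -big_split /=.
apply: eq_bigr => i _; congr (_ * _).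
by rewrite natrB // -natr1; ring.
Qed.

Lemma falling_ge0 (R : numDomainType) (x : R) (k : nat) :
  k%:R <= x -> 0 <= falling x k.
Proof.
move=> kx; apply: prodr_ge0 => i _; rewrite subr_ge0.
by apply: le_trans kx; rewrite ler_nat ltnW.
Qed.

Lemma falling_sqr_bounds (R : realFieldType) (x : R) (k : nat) :
  k%:R <= x ->
  (x * (x - k%:R + 1)) ^+ k <= falling x k ^+ 2
    <= ((x - (k%:R - 1) / 2) ^+ 2) ^+ k.
Proof.
move=> kx.
have expE (z : R) : z ^+ k = \prod_(i < k) z by rewrite prodr_const card_ord.
rewrite falling_sqr !expE.
have k0 : 0 <= k%:R :> R by [].
apply/andP; split; apply: ler_prod => i _;
  have ik : i%:R + 1 <= k%:R :> R by rewrite natr1 ler_nat.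
all: have i0 : 0 <= i%:R :> R by [].
all: apply/andP; split.
- by apply: mulr_ge0; lra.
(* This product is exactly the excess of the [i]-th pair over [x * (x - k%:R + 1)]. *)
- have : 0 <= i%:R * (k%:R - 1 - i%:R) :> R by apply: mulr_ge0 => //; lra.
  by lra.
- by apply: mulr_ge0; lra.
- by have := sqr_ge0 ((k%:R - 1) / 2 - i%:R : R); lra.
Qed.

Lemma powR_invn_expn (R : realType) (x : R) (k : nat) :
  (0 < k)%N -> 0 <= x -> (x `^ k%:R^-1) ^+ k = x.
Proof.
move=> k0 x0; rewrite -powR_mulrn ?powR_ge0// -powRrM mulVf ?powRr1//.
by rewrite pnatr_eq0 -lt0n.
Qed.

Theorem theorem3p3 (R : realType) (k a : nat) (c : R) :
  (2 <= k)%N ->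
  k%:R < c ->
  root (fallingP R k a) c ->
  c \in `[ a`!%:R `^ k%:R^-1 + (k%:R - 1) / 2,
           a`!%:R `^ k%:R^-1 + (k%:R - 1) / 2 + k%:R ^+ 2 / (c - k%:R) ].
Proof.
move=> k2 kc; rewrite /root /fallingP hornerD hornerN hornerC horner_falling.
rewrite subr_eq0 => /eqP <-.
have k_gt0 : (0 < k)%N by exact: ltnW.
have k1 : 2 <= k%:R :> R by rewrite ler_nat.
have := falling_sqr_bounds R c k (ltW kc).
have := powR_invn_expn R _ _ k_gt0 (falling_ge0 R c k (ltW kc)).
set r := _ `^ _ => rk; rewrite -rk.
have r0 : 0 <= r by exact: powR_ge0.
(* As [(r ^+ 2) ^+ k], the middle term allows cancelling the exponent [k] throughout. *)
rewrite [r ^+ k ^+ 2]exprAC !(ler_pXn2r k_gt0) ?nnegrE ?sqr_ge0//;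
  last by apply: mulr_ge0; lra.
case/andP=> lo hi.
set t := k%:R ^+ 2 / (c - k%:R).
have tE : t * (c - k%:R) = k%:R ^+ 2 by rewrite /t divfK// subr_eq0 gt_eqF.
have t0 : 0 <= t by rewrite divr_ge0 ?sqr_ge0// subr_ge0 ltW.
clearbody t; clear rk; clearbody r.
rewrite in_itv /=; apply/andP; split.
  have y0 : 0 <= c - (k%:R - 1) / 2 by lra.
  by move: hi; rewrite ler_pXn2r ?nnegrE// => hi; lra.
(* If [y <= t], then [r >= 0] suffices; otherwise [y - t] is positive and can be squared. *)
case: (leP (c - (k%:R - 1) / 2) t) => ty; first by lra.
suff : c - (k%:R - 1) / 2 - t <= r by lra.
rewrite -(ler_pXn2r (n := 2)) ?nnegrE ?subr_ge0 ?(ltW ty)//.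
(* The left side of [lo] is [y ^ 2 - m ^ 2]. *)
apply: le_trans lo.
have yt : t * (c - k%:R) <= t * (c - (k%:R - 1) / 2) by apply: ler_wpM2l => //; lra.
have tt : t * t <= t * (c - (k%:R - 1) / 2) by apply: ler_wpM2l => //; lra.
nra.
Qed.
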